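(* Let $G$ be a finite non-abelian group with an abelian subgroup of index two. Then $G$ has a connected Cayley graph admitting perfect state transfer if and only if $4$ divides $|G|$.
   Context: A Cayley graph of $G$ is a graph $\mathrm{Cay}(G,S)$, where $S\subseteq G\setminus\{1_G\}$ is inverse-closed, with vertex set $G$ and $g\sim h$ if and only if $hg^{-1}\in S$. For a graph $X$ with adjacency matrix $A$, put $U(t)=\exp(itA)$; $X$ admits perfect state transfer if $|U(\tau)_{v,u}|=1$ for some distinct vertices $u,v$ and some time $\tau$. *)

(* Defs.v *)
From mathcomp Require Export all_boot all_order all_algebra all_fingroup.
From mathcomp Require Export all_classical all_reals all_analysis.
From mathcomp Require Export complex.
Export numFieldNormedType.Exports.

Set Implicit Arguments.
Unset Strict Implicit.
Unset Printing Implicit Defensive.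

Import Order.TTheory GRing.Theory Num.Theory.
Local Open Scope ring_scope.

(* The limit is taken in the topology of 'M[K]_n, i.e. entrywise. *)
Definition expmx (K : numFieldType) (n : nat) (A : 'M[K]_n) : 'M[K]_n :=
  limn (fun N => \sum_(k < N) (k`!%:R)^-1 *: A ^+ k).

Section Graph.
Variables (R : realType) (V : finType) (e : rel V).

(* Rows and columns are indexed by the vertices through enum_val/enum_rank. *)
Definition adjmx : 'M[R[i]]_#|V| :=
  \matrix_(j, k) (e (enum_val j) (enum_val k))%:R.

Definition transition_mx (t : R) : 'M[R[i]]_#|V| :=
  expmx (('i * t%:C%C) *: adjmx).

Definition perfect_state_transfer : Prop :=
  exists u v : V, u != v /\
    exists tau : R, `|transition_mx tau (enum_rank v) (enum_rank u)| = 1.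

Definition connected_graph : Prop := forall u v : V, connect e u v.

End Graph.

Section Cayley.
Variable gT : finGroupType.

Definition connection_set (S : {set gT}) : Prop :=
  1%g \notin S /\ forall s, s \in S -> s^-1%g \in S.

Definition cayley (S : {set gT}) : rel gT := fun g h => (h * g^-1)%g \in S.

End Cayley.

Arguments perfect_state_transfer R {V} e.

(* Main.v *)
Require Import Defs.
From mathcomp Require Import all_solvable spectral ring lra zify.

Set Implicit Arguments.
Unset Strict Implicit.
Unset Printing Implicit Defensive.

Import Order.TTheory GRing.Theory Num.Theory.
Local Open Scope ring_scope.

(* If 4 divides |G|, take an involution z and S = G \ {1, z}: the adjacency matrix is
   J - I - L_z with L_z the left translation by z, and at time pi/2 the transition
   matrix is -L_z.

   Conversely suppose that H, abelian of index 2, has odd order m.  Perfect state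
   transfer at time tau forces U(tau) = lam L_z for an involution z, which is outside
   H and satisfies z S z = S.  Write the sum of S as s + t z with s, t in Z[H].  On the
   eigenspaces of z it acts as s + t and s - t, so the eigenvalues of s + t lie in
   |S| + (2 pi / tau) Z and those of s - t in |S| + (pi / tau) (2 Z + 1).  Comparing
   the traces of the two gives 2 m tau = pi w with w odd, so w (s + t - |S|) has
   all its eigenvalues in 4 Z.  Modulo 2 an element of Z[H] with even eigenvalues is
   nilpotent, hence zero since Frobenius is injective on F_2[H] for |H| odd; applying
   this twice, 4 divides all coefficients of w (s + t - |S|).  As s + t has
   coefficients in {0, 1, 2}, it is supported at 1, so S is contained in {z}
   and cannot generate G. *)

(** * The circle exponential and the transition matrix *)

Section CircleExponential.
Local Open Scope complex_scope.
Local Open Scope classical_set_scope.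
Variable R : realType.
Implicit Types x y t : R.
Let K : numFieldType := R[i].

Definition expi x : R[i] := cos x +i* sin x.

Lemma expiD x y : expi (x + y) = expi x * expi y.
Proof.
by apply/eqP; rewrite eq_complex /= cosD sinD addrC [X in _ && (X == _)]addrC !eqxx.
Qed.

Lemma normr_expi x : `|expi x| = 1.
Proof. by rewrite normc_def /= cos2Dsin2 sqrtr1. Qed.

(** Subtracting the multiple of [2 pi] given by the floor puts the argument in [[0, 2 pi)]. There
    [cos] is injective on [[0, pi]], and a value beyond [pi] is reflected to [2 pi - y]. *)
Lemma cos_eq1 x : cos x = 1 -> exists n : int, x = n%:~R * (pi *+ 2).
Proof.
move=> cx1; have pi0 : 0 < (pi : R) := pi_gt0 R; have p2 : 0 < (pi : R) *+ 2 by rewrite mulrn_wgt0.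
pose n := Num.floor (x / (pi *+ 2)); exists n.
have cosZ (m : nat) y : cos (y + m%:R * (pi *+ 2)) = cos y.
  by rewrite mulr_natl (periodicn (@cosD2pi R)).
pose y := x - n%:~R * (pi *+ 2).
have cy : cos y = 1.
  rewrite -cx1 {}/y; case: (n) => m /=.
    by rewrite -{2}(subrK (m%:R * (pi *+ 2)) x) cosZ.
  by rewrite NegzE mulrNz mulNr opprK pmulrn cosZ.
have y0 : 0 <= y.
  by rewrite subr_ge0 -ler_pdivlMr ?floor_le // pmulrn_lgt0.
have yp : y < pi *+ 2.
  rewrite ltrBlDr -[X in _ < X + _]mul1r -mulrDl -ltr_pdivrMr ?p2 //.
  by rewrite addrC -(intrD _ _ 1) floorD1_gt.
have [yle|ygt] := leP y pi.
  have : y = 0.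
    apply: cos_inj; rewrite ?cy ?cos0 // in_itv /= ?y0 ?yle //.
    by rewrite lexx pi_ge0.
  by move/eqP; rewrite /y subr_eq0 => /eqP.
have : pi *+ 2 - y = 0.
  apply: cos_inj; rewrite ?in_itv /= ?lexx ?pi_ge0 //.
    by rewrite mulr2n; apply/andP; split; lra.
  by rewrite cos0 addrC cosD2pi cosN.
by lra.
Qed.

Lemma expi_eq1 x : expi x = 1 -> exists n : int, x = n%:~R * (pi *+ 2).
Proof. by move/eqP; rewrite eq_complex => /andP[/eqP/cos_eq1]. Qed.

Lemma expi_pi : expi pi = -1.
Proof. by apply/eqP; rewrite eq_complex /= cospi sinpi oppr0 !eqxx. Qed.

Lemma expi_natpi (n : nat) : expi (n%:R * pi) = (-1) ^+ n.
Proof.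
elim: n => [|n IHn].
  by rewrite mul0r; apply/eqP; rewrite eq_complex /= cos0 sin0 !eqxx.
by rewrite -addn1 natrD mulrDl mul1r expiD IHn expi_pi exprD expr1.
Qed.

Lemma cvg_complex (u v : R^nat) (a b : R) :
  u @ \oo --> a -> v @ \oo --> b ->
  (fun n => u n +i* v n : K) @ \oo --> (a +i* b : K).
Proof.
move=> ua vb; apply/cvgrPdist_lt => /= e e0.
(* A positive element of [R[i]] is real, so the tolerance can be halved in [R] and shared between
   the two coordinates. *)
have [d d0 ->] : exists2 d : R, 0 < d & e = (d + d)%:C.
  have /complex_realP[k ek] : e \is Num.real by exact: gtr0_real.
  exists (k / 2); last by rewrite -splitr.
  by move: e0; rewrite ek ltcR => k0; rewrite divr_gt0.
move/cvgrPdist_lt : ua => /(_ _ d0) ua; move/cvgrPdist_lt : vb => /(_ _ d0) vb.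
near=> n.
have -> : (a +i* b : R[i]) - (u n +i* v n) = (a - u n)%:C + 'i%C * (b - v n)%:C.
  by rewrite [LHS]complexE.
apply: le_lt_trans (ler_normD _ _) _; rewrite normrM !normc_def /=.
rewrite !(expr0n, expr1n, addr0, add0r) /= sqrtr1 mul1r !sqrtr_sqr -(rmorphD (real_complex R)) ltcR.
by apply: ltrD; near: n.
Unshelve. all: by end_near. Qed.

(** As ['i ^+ n] is a sign [(-1) ^+ n./2] times ['i] or [1] according to parity, the partial sums
    have those of the cosine and sine series as real and imaginary parts. *)
Lemma expi_series x :
  (fun n => \sum_(k < n) (k`!%:R)^-1 * ('i * x%:C) ^+ k : K) @ \oo --> (expi x : K).
Proof.
have E : (fun n => \sum_(k < n) (k`!%:R)^-1 * ('i * x%:C) ^+ k : R[i]) =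
    (fun n => series (cos_coeff x) n +i* series (sin_coeff x) n).
  apply/funext => n; rewrite /series /= !big_mkord.
  elim: n => [|n IHn]; first by rewrite !big_ord0.
  rewrite !big_ord_recr /= {}IHn exprMn.
  have -> : ('i : R[i]) ^+ n = (-1) ^+ n./2 * (if odd n then 'i%C else 1).
    rewrite -{1}(odd_double_half n) exprD -mul2n exprM sqrCi mulrC; congr (_ * _).
    by case: odd; rewrite ?expr1 ?expr0 // complexiE.
  have -> : (n`!%:R : R[i])^-1 = (n`!%:R^-1 : R)%:C by rewrite fmorphV rmorph_nat.
  have -> : (-1 : R[i]) ^+ n./2 = ((-1) ^+ n./2)%:C by rewrite rmorphXn rmorphN1.
  rewrite -rmorphXn /= /cos_coeff /sin_coeff /=.
  case: (boolP (odd n)) => on.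
    rewrite (_ : n.-1./2 = n./2); last by lia.
    apply/eqP; rewrite eq_complex /=; apply/andP; split; apply/eqP; ring.
  by rewrite mulr1 -exprnP; apply/eqP; rewrite eq_complex /=; apply/andP; split; apply/eqP; ring.
rewrite E; apply: cvg_complex; rewrite /expi.
  by rewrite cos.unlock; exact: is_cvg_series_cos_coeff.
by rewrite sin.unlock; exact: is_cvg_series_sin_coeff.
Qed.

End CircleExponential.

(** * Exponential and functional calculus of diagonalizable matrices *)

Section MatrixExponential.
Local Open Scope classical_set_scope.

Lemma cvg_mx (K : numFieldType) m n (f : nat -> 'M[K]_(m, n)) (l : 'M[K]_(m, n)) :
  (forall i j, (fun N => f N i j) @ \oo --> l i j) -> f @ \oo --> l.
Proof.
move=> fl A [P lP sPA]; apply: filterS sPA _.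
have : \forall N \near \oo, forall ij : 'I_m * 'I_n, P ij.1 ij.2 (f N ij.1 ij.2).
  by apply: filter_forall => ij; apply: fl; exact: lP.
by apply: filterS => N h i j; exact: (h (i, j)).
Qed.

(** Conjugation passes through powers, so each entry of a partial sum is a fixed linear combination
    of the scalar partial sums at the [d 0 j]. *)
Lemma expmx_similar_diag (K : numFieldType) n (P : 'M[K]_n) (d e : 'rV[K]_n) :
  P \in unitmx ->
  (forall j, (fun N => \sum_(k < N) (k`!%:R)^-1 * d 0 j ^+ k) @ \oo --> e 0 j) ->
  expmx (invmx P *m diag_mx d *m P) = invmx P *m diag_mx e *m P.
Proof.
move=> uP de; apply: cvg_lim; first exact: norm_hausdorff.
have powE k : (invmx P *m diag_mx d *m P) ^+ k =
    invmx P *m diag_mx (map_mx (fun x => x ^+ k) d) *m P.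
  elim: k => [|k IHk].
    rewrite expr0 (_ : map_mx _ _ = const_mx 1) ?diag_const_mx ?mulmx1 ?mulVmx //.
    by apply/rowP => j; rewrite !mxE expr0.
  rewrite exprS {}IHk -[LHS]/(_ *m _) !mulmxA mulmxK //; congr (_ *m _).
  rewrite -!mulmxA; congr (_ *m _); rewrite mulmx_diag; congr diag_mx.
  by apply/rowP => j; rewrite !mxE exprS.
apply: cvg_mx => i j.
have E (c : 'rV[K]_n) : (invmx P *m diag_mx c *m P) i j =
    \sum_k invmx P i k * c 0 k * P k j.
  rewrite mul_mx_diag !mxE; apply: eq_bigr => k _; by rewrite !mxE.
under eq_fun do rewrite summxE.
rewrite E.
rewrite (_ : (fun N => _) = fun N => \sum_k invmx P i k *
   (\sum_(l < N) (l`!%:R)^-1 * d 0 k ^+ l) * P k j); last first.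
  apply/funext => N; under eq_bigr do rewrite mxE powE E big_distrr /=.
  rewrite exchange_big /=; apply: eq_bigr => k _.
  rewrite mulr_sumr mulr_suml; apply: eq_bigr => l _; rewrite !mxE; ring.
apply: cvg_big => [|k _]; first exact: add_continuous.
by apply: cvgMr_tmp; apply: cvgMl_tmp; exact: de.
Qed.

End MatrixExponential.

(** Entrywise, the hypothesis says that [a 0 i = b 0 j] wherever [W i j] is nonzero, which survives
    any function [f]. Eigenvectors, commutation and symmetry are all transferred from a matrix to a
    function of it in this way. *)
Lemma diag_mx_intertwine (K : fieldType) m n (W : 'M[K]_(m, n)) a b (f : K -> K) :
  diag_mx a *m W = W *m diag_mx b ->
  diag_mx (map_mx f a) *m W = W *m diag_mx (map_mx f b).
Proof.
rewrite !mul_diag_mx !mul_mx_diag => /matrixP aW; apply/matrixP => i j.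
have := aW i j; rewrite !mxE [RHS]mulrC.
have [->|W0] := eqVneq (W i j) 0; first by rewrite !mulr0 !mul0r.
by move/(mulIf W0) ->; rewrite mulrC.
Qed.

Section SimilarDiag.
Variables (K : fieldType) (n : nat) (P : 'M[K]_n) (d : 'rV[K]_n) (f : K -> K).
Hypothesis uP : P \in unitmx.
Local Notation A := (invmx P *m diag_mx d *m P).
Local Notation fA := (invmx P *m diag_mx (map_mx f d) *m P).

Lemma similar_diag_eigen (y : 'rV[K]_n) a :
  y *m A = a *: y ->
  exists2 w, y = w *m P & diag_mx (const_mx a : 'rV_1) *m w = w *m diag_mx d.
Proof.
move=> yA; exists (y *m invmx P); first by rewrite mulmxKV.
by rewrite diag_const_mx mul_scalar_mx scalemxAl -yA !mulmxA mulmxK.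
Qed.

Lemma similar_diag_map_eigen (y : 'rV[K]_n) a : y *m A = a *: y -> y *m fA = f a *: y.
Proof.
move=> /similar_diag_eigen[w -> /(diag_mx_intertwine f) wD].
rewrite !mulmxA mulmxK // -wD (_ : map_mx _ _ = const_mx (f a)).
  by rewrite diag_const_mx mul_scalar_mx -scalemxAl.
by apply/rowP => j; rewrite !mxE.
Qed.

Lemma similar_diag_map_comm (X : 'M[K]_n) : X *m A = A *m X -> X *m fA = fA *m X.
Proof.
move=> XA; have : diag_mx d *m (P *m X *m invmx P) = (P *m X *m invmx P) *m diag_mx d.
  have -> : diag_mx d = P *m A *m invmx P by rewrite !mulmxA mulmxV // mul1mx mulmxK.
  rewrite -[in LHS](mulmxA _ (invmx P)) -(mulmxA P A) -[RHS]mulmxA.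
  move: (A) XA => B XA.
  by rewrite !mulmxA !mulmxKV // -!(mulmxA P) XA.
move/(diag_mx_intertwine f); move: (diag_mx _) => D DX.
have := congr1 (fun Y => invmx P *m Y *m P) DX.
by rewrite -!mulmxA mulVmx // mulmx1 !mulmxA mulVmx // mul1mx.
Qed.

Lemma tr_similar_diag_map : A^T = A -> fA^T = fA.
Proof.
(* Symmetry of [A] amounts to [P *m P^T] commuting with the diagonal matrix, a form to which the
   intertwining lemma applies. *)
move=> trA; have : diag_mx d *m (P *m P^T) = (P *m P^T) *m diag_mx d.
  have dP : diag_mx d *m P = P *m A by rewrite !mulmxA mulmxV // mul1mx.
  by rewrite mulmxA dP -mulmxA -{1}trA -trmx_mul -dP trmx_mul tr_diag_mx mulmxA.
move/(diag_mx_intertwine f); move: (map_mx f d) => e h.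
rewrite !trmx_mul tr_diag_mx.
apply: (can_inj (mulKmx uP)); rewrite !mulmxA -h mulmxV // mul1mx.
by rewrite -!mulmxA -trmx_mul mulVmx // trmx1 mulmx1.
Qed.

End SimilarDiag.

(** * Spectral form of the transition matrix of an undirected graph *)

Section Transition.
Local Open Scope complex_scope.
Local Open Scope classical_set_scope.
Local Open Scope sesquilinear_scope.
Variables (R : realType) (V : finType) (e : rel V).
Hypothesis e_sym : symmetric e.
Local Notation K := R[i].
Local Notation A := (adjmx R e).
Local Notation U := (transition_mx e).
Local Notation P := (spectralmx A).
Local Notation d := (spectral_diag A).
(** The eigenvalues it is applied to are real, so taking [complex.Re] only changes their type. *)
Let phase (t : R) (x : K) : K := expi (t * complex.Re x).

Lemma tr_adjmx : A^T = A.
Proof. by apply/matrixP => i j; rewrite !mxE e_sym. Qed.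

Lemma adjmx_hermsym : A \is hermsymmx.
Proof.
apply/is_hermitianmxP; rewrite expr0 scale1r tr_adjmx.
by apply/matrixP => i j; rewrite !mxE conjC_nat.
Qed.

Lemma adjmx_spectral : A = invmx P *m diag_mx d *m P.
Proof. exact/orthomx_spectralP/hermitian_normalmx/adjmx_hermsym. Qed.

Lemma spectral_diag_adjmx_real j : d 0 j \is Num.real.
Proof. exact: (mxOverP (hermitian_spectral_diag_real adjmx_hermsym)). Qed.

Lemma transition_mxE (t : R) : U t = invmx P *m diag_mx (map_mx (phase t) d) *m P.
Proof.
rewrite /transition_mx [in LHS]adjmx_spectral.
rewrite -mulmxA scalemxAr scalemxAl -linearZ /= mulmxA.
apply: expmx_similar_diag; first exact: spectral_unit.
move=> j; rewrite !mxE.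
have -> : 'i * t%:C * d 0 j = 'i * (t * complex.Re (d 0 j))%:C.
  by rewrite rmorphM /= RRe_real ?spectral_diag_adjmx_real // mulrA.
exact: expi_series.
Qed.

Lemma eigenvalue_adjmx_real (y : 'rV[K]_#|V|) a :
  y != 0 -> y *m A = a *: y -> a \is Num.real.
Proof.
move=> y0 yA; rewrite adjmx_spectral in yA.
have [w yE wD] := similar_diag_eigen (spectral_unit A) yA.
have /rV0Pn[j wj] : w != 0 by apply: contraNneq y0 => w0; rewrite yE w0 mul0mx.
have /matrixP/(_ 0 j) := wD.
rewrite diag_const_mx mul_scalar_mx mul_mx_diag !mxE [RHS]mulrC => /(mulIf wj) ->.
exact: spectral_diag_adjmx_real.
Qed.

Lemma transition_mx_eigen (y : 'rV[K]_#|V|) a t :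
  y *m A = a *: y -> y *m U t = expi (t * complex.Re a) *: y.
Proof.
move=> yA; rewrite adjmx_spectral in yA; rewrite transition_mxE.
exact: (similar_diag_map_eigen (phase t) (spectral_unit A)) yA.
Qed.

Lemma transition_mx_comm (X : 'M[K]_#|V|) t : X *m A = A *m X -> X *m U t = U t *m X.
Proof.
move=> XA; rewrite adjmx_spectral in XA; rewrite transition_mxE.
exact: (similar_diag_map_comm (phase t) (spectral_unit A)) XA.
Qed.

Lemma tr_transition_mx (t : R) : (U t)^T = U t.
Proof.
have trA : A^T = A := tr_adjmx; rewrite adjmx_spectral in trA; rewrite transition_mxE.
exact: (tr_similar_diag_map (phase t) (spectral_unit A)) trA.
Qed.

Lemma transition_mx_unitary (t : R) : U t \is unitarymx.
Proof.
rewrite transition_mxE invmx_unitary ?spectral_unitarymx //.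
rewrite !mul_unitarymx ?trmxC_unitary ?spectral_unitarymx //.
apply/unitarymxP; rewrite tr_diag_mx map_diag_mx mulmx_diag -diag_const_mx.
by congr diag_mx; apply/rowP => j; rewrite !mxE -normCK normr_expi expr1n.
Qed.

End Transition.

(** * Group algebra matrices *)

Lemma sum_enum_val (M : nmodType) (T : finType) (F : T -> M) :
  \sum_(i < #|T|) F (enum_val i) = \sum_x F x.
Proof. by rewrite [RHS](reindex _ (onW_bij _ (enum_val_bij T))). Qed.

(** On row vectors this is left convolution by [f], that is, left multiplication by an element of
    the group algebra. Row action reverses the order of products. *)
Definition circ (R : pzRingType) (gT : finGroupType) (f : gT -> R) : 'M[R]_#|gT| :=
  \matrix_(i, j) f (enum_val j * (enum_val i)^-1)%g.

Lemma map_circ (R S : pzRingType) (gT : finGroupType) (phi : R -> S) (f : gT -> R) :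
  map_mx phi (circ f) = circ (phi \o f).
Proof. by apply/matrixP => i j; rewrite !mxE. Qed.

Lemma mul_row_circ (R : pzRingType) (gT : finGroupType) (y f : gT -> R) :
  (\row_j y (enum_val j)) *m circ f =
  \row_j \sum_x y (x^-1 * enum_val j)%g * f x.
Proof.
apply/rowP => j; rewrite !mxE.
under eq_bigr do rewrite !mxE.
rewrite (sum_enum_val (fun x => y x * f (enum_val j * x^-1)%g)).
rewrite (reindex_inj (h := fun x => (x^-1 * enum_val j)%g)) => [|x x' /mulIg/invg_inj//].
by apply: eq_bigr => x _; rewrite invMg invgK mulgA mulgV mul1g.
Qed.

Lemma mxtrace_circ (R : pzRingType) (gT : finGroupType) (f : gT -> R) :
  \tr (circ f) = f 1%g *+ #|gT|.
Proof.
rewrite /mxtrace; under eq_bigr do rewrite mxE mulgV.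
by rewrite sumr_const card_ord.
Qed.

Lemma circ_sum (R : pzRingType) (gT : finGroupType) (f : gT -> R) :
  circ f = \sum_h f h *: circ (fun x => (x == h)%:R).
Proof.
apply/matrixP => i j; rewrite !mxE summxE (bigD1 (enum_val j * (enum_val i)^-1)%g) //=.
rewrite !mxE eqxx mulr1 big1 ?addr0 // => h hE.
by rewrite !mxE eq_sym (negPf hE) mulr0.
Qed.

Lemma mul_circ_delta (R : pzRingType) (gT : finGroupType) (a b : gT) :
  circ (fun x => (x == a)%:R) *m circ (fun x => (x == b)%:R) =
  circ (fun x => (x == b * a)%g%:R) :> 'M[R]__.
Proof.
apply/matrixP => i j; rewrite !mxE; under eq_bigr do rewrite !mxE -natrM mulnb.
rewrite (sum_enum_val (fun x => ((x * (enum_val i)^-1 == a) &&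
  (enum_val j * x^-1 == b))%g%:R)).
rewrite (bigD1 (a * enum_val i)%g) //= mulgK eqxx big1 => [|x xE]; last first.
  by rewrite -(can2_eq (mulgKV _) (mulgK _)) eq_sym in xE; rewrite eq_sym (negPf xE).
rewrite addr0 invMg mulgA; congr (nat_of_bool _)%:R.
by apply/eqP/eqP => [<-|->]; rewrite ?mulgKV ?mulgK.
Qed.

Lemma sqr_sum_pchar2 (R : pzRingType) (I : Type) (r : seq I) (F : I -> R) :
  2%:R = 0 :> R -> (forall i j, GRing.comm (F i) (F j)) ->
  (\sum_(i <- r) F i) ^+ 2 = \sum_(i <- r) F i ^+ 2.
Proof.
move=> R2 Fc; elim: r => [|i r IHr]; first by rewrite !big_nil expr0n.
have FS : GRing.comm (F i) (\sum_(j <- r) F j) by apply: commr_sum => j _; exact: Fc.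
rewrite !big_cons -IHr expr2 mulrDl !mulrDr -!expr2 -FS -addrA; congr (_ + _).
by rewrite addrA -mulr2n -mulr_natl R2 mul0r add0r.
Qed.

(* In characteristic 2 the Frobenius map on F_2[G] sends a sum of group elements
   to the sum of their squares, and squaring is injective on a group of odd order. *)
Lemma circ_F2_nilpotent (gT : finGroupType) (f : gT -> 'F_2) n :
  abelian [set: gT] -> odd #|gT| -> circ f ^+ n = 0 -> f =1 fun=> 0.
Proof.
move=> /centsP cG oG fn0.
have comm (x y : gT) : (x * y = y * x)%g by apply: cG; rewrite inE.
pose L (h : gT) : 'M['F_2]_#|gT| := circ (fun x => (x == h)%:R).
have LM a b : L a * L b = L (a * b)%g by rewrite comm; exact: mul_circ_delta.
have pow N : circ f ^+ (2 ^ N) = \sum_h f h *: L (h ^+ (2 ^ N))%g.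
  elim: N => [|N IHN]; first exact: circ_sum.
  rewrite expnSr exprM IHN sqr_sum_pchar2 => [||h k].
  - apply: eq_bigr => h _; rewrite expr2 -[LHS]/(_ *m _) -scalemxAl -scalemxAr scalerA.
    rewrite [L _ *m _]LM -expgD addnn -muln2 -?expnSr.
    by congr (_ *: _); case: (f h) => [[|[|[]]]] //= i; apply/val_inj.
  - by apply/matrixP => i j; rewrite !mxE; case: eqP => _; apply/val_inj.
  - rewrite /GRing.comm -[LHS]/(_ *m _) -[RHS]/(_ *m _).
    rewrite -!scalemxAl -!scalemxAr !scalerA [f h * _]mulrC; congr (_ *: _).
    by rewrite [LHS]LM [RHS]LM comm.
have inj : injective (fun x : gT => x ^+ (2 ^ n))%g.
  have co : coprime #|[set: gT]| (2 ^ n) by rewrite coprimeXr // coprimen2 cardsT.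
  move=> x y xy; rewrite -(expgK co (finset.in_setT x)) -(expgK co (finset.in_setT y)).
  by congr (_ ^+ _)%g.
move=> g; have := pow n.
(* Since [n <= 2 ^ n], the power [2 ^ n] vanishes too. Its entry at row [1] and column
   [g ^+ (2 ^ n)] is [f g], by injectivity of that power map. *)
rewrite -(subnKC (ltnW (ltn_expl n (isT : 1 < 2)%N))) exprD fn0 mul0r.
rewrite subnKC ?(ltnW (ltn_expl _ _)) //.
move=> /matrixP/(_ (enum_rank 1%g) (enum_rank (g ^+ (2 ^ n))%g)).
rewrite mxE summxE (bigD1 g) //= !mxE !enum_rankK invg1 mulg1 eqxx mulr1 big1 ?addr0 //.
by move=> h hg; rewrite !mxE !enum_rankK invg1 mulg1 (inj_eq inj) eq_sym (negPf hg) mulr0.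
Qed.

Lemma char_poly_Xn_nilpotent (F : comNzRingType) n (M : 'M[F]_n) k :
  char_poly M = 'X^k -> M ^+ k = 0.
Proof.
case: n M => [|n] M; first by rewrite (flatmx0 (_ ^+ _)) flatmx0.
by move=> Mk; have := Cayley_Hamilton M; rewrite Mk rmorphXn /= horner_mx_X.
Qed.

(** Over [C] the characteristic polynomial is a product of factors ['X - 2c]. Since [int] embeds in
    [C], the same factorization holds over the integers, and modulo 2 every factor becomes ['X]. *)
Lemma char_poly_int_even (C : numClosedFieldType) n (M : 'M[int]_n) :
  (forall a, eigenvalue (map_mx intr M : 'M[C]_n) a -> exists c : int, a = (c * 2)%:~R) ->
  exists k, char_poly (map_mx intr M : 'M['F_2]_n) = 'X^k.
Proof.
move=> ev; have [r rE] := closed_field_poly_normal (char_poly (map_mx intr M : 'M[C]_n)).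
have [s sE] : exists s : seq int, r = [seq (c * 2)%:~R | c <- s].
  have : forall x, x \in r -> exists c : int, x = (c * 2)%:~R.
    move=> x xr; apply: ev; rewrite eigenvalue_root_char rE rootZ ?root_prod_XsubC //.
    by rewrite (monicP (char_poly_monic _)) oner_eq0.
  elim: r {rE} => [|x r IHr] xr; first by exists [::].
  have [|s ->] := IHr; first by move=> y yr; apply: xr; rewrite inE yr orbT.
  by have [c ->] := xr x (mem_head _ _); exists (c :: s).
have pE : char_poly M = \prod_(c <- s) ('X - (c * 2)%:P).
  apply: (map_inj_poly (f := intr : int -> C)) => //; first exact: intr_inj.
  rewrite map_char_poly rE (monicP (char_poly_monic _)) scale1r sE big_map rmorph_prod /=.
  by apply: eq_bigr => c _; rewrite rmorphB /= map_polyX map_polyC.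
exists (size s); rewrite -map_char_poly pE rmorph_prod /=.
rewrite (eq_bigr (fun=> 'X)) => [|c _]; first by rewrite big_const_seq count_predT iter_mulr_1.
rewrite rmorphB /= map_polyX map_polyC /=.
by rewrite (_ : (c * 2)%:~R = 0) ?subr0 // intrM (_ : 2%:~R = 0) ?mulr0 //; apply/val_inj.
Qed.

(** By Cayley-Hamilton the reduction modulo 2 is nilpotent, hence zero in the reduced algebra
    [F_2[G]]. *)
Lemma circ_even (C : numClosedFieldType) (gT : finGroupType) (f : gT -> int) :
  abelian [set: gT] -> odd #|gT| ->
  (forall a, eigenvalue (circ (fun g => (f g)%:~R : C)) a ->
     exists c : int, a = (c * 2)%:~R) ->
  forall g, (2 %| f g)%Z.
Proof.
move=> cG oG ev g.
have [|k /char_poly_Xn_nilpotent] := @char_poly_int_even C _ (circ f).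
  by move=> a; rewrite map_circ; exact: ev.
rewrite map_circ => /(circ_F2_nilpotent cG oG)/(_ g) /= /eqP.
by rewrite -(dvdz_pcharf (pchar_Fp _)).
Qed.

Lemma circ_dvd4 (C : numClosedFieldType) (gT : finGroupType) (f : gT -> int) :
  abelian [set: gT] -> odd #|gT| ->
  (forall a, eigenvalue (circ (fun g => (f g)%:~R : C)) a ->
     exists c : int, a = (c * 4)%:~R) ->
  forall g, (4 %| f g)%Z.
Proof.
move=> cG oG ev.
have f2 g : f g = (f g %/ 2)%Z * 2.
  rewrite divzK //; apply: (circ_even (C := C)) g => // a /ev[c ->].
  by exists (c * 2); rewrite -mulrA.
move=> g; rewrite f2 (@dvdz_mul 2 2) //.
(* All coefficients are even by the first pass; halving them halves the eigenvalues, which are then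
   still even. *)
apply: (circ_even (C := C) (f := fun h => (f h %/ 2)%Z)) g => // a /eigenvalueP[x xE x0].
have [|c ac] := ev (a * 2).
  apply/eigenvalueP; exists x => //.
  rewrite (_ : circ _ = 2 *: circ (fun g => (f g %/ 2)%Z%:~R)).
    by rewrite -scalemxAr xE scalerA mulrC.
  by apply/matrixP => i j; rewrite !mxE {1}f2 intrM mulrC.
exists c; apply: (mulIf (_ : 2 != 0 :> C)); first by rewrite pnatr_eq0.
by rewrite ac !intrM; ring.
Qed.

(** The list is that of the roots of the characteristic polynomial with multiplicity; it carries a
    property of single eigenvalues over to the trace. *)
Lemma mxtrace_eigenvalues (C : closedFieldType) n (M : 'M[C]_n) (Q : C -> Prop) :
  (0 < n)%N -> (forall a, eigenvalue M a -> Q a) ->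
  exists r : seq C, [/\ size r = n, forall a, a \in r -> Q a & \tr M = \sum_(a <- r) a].
Proof.
move=> n0 ev; have [r rE] := closed_field_poly_normal (char_poly M).
rewrite (monicP (char_poly_monic _)) scale1r in rE.
have sr : size r = n by have := size_char_poly M; rewrite rE size_prod_XsubC => -[].
exists r; split=> // [a ar|].
  by apply: ev; rewrite eigenvalue_root_char rE root_prod_XsubC.
have := char_poly_trace M n0.
by rewrite rE -{1}sr coefPn_prod_XsubC ?sr -?lt0n // => /oppr_inj.
Qed.

(** * Perfect state transfer on Cayley graphs *)

(** The squared moduli along a row sum to 1, so one entry of modulus 1 exhausts the row. *)
Lemma unitarymx_norm1 (C : numClosedFieldType) n (M : 'M[C]_n) i j k :
  M \is unitarymx -> `|M i j| = 1 -> k != j -> M i k = 0.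
Proof.
move=> /unitarymxP/matrixP/(_ i i) uM Mij kj; move: uM; rewrite !mxE eqxx.
under eq_bigr do rewrite !mxE -normCK.
rewrite (bigD1 j) //= Mij expr1n -[RHS]addr0 => /addrI s0.
 have /(_ k kj)/eqP := psumr_eq0P (fun l _ => exprn_ge0 2 (normr_ge0 (M i l))) s0.
by rewrite expf_eq0 /= normr_eq0 => /eqP.
Qed.

Section CayleyGraph.
Variables (R : realType) (gT : finGroupType) (S : {set gT}).
Hypothesis S_conn : connection_set S.
Local Notation K := R[i].
Local Notation A := (adjmx R (cayley S)).
Local Notation U := (transition_mx (cayley S)).
Local Notation "y ^row" := (\row_j (y : gT -> K) (enum_val j)) (at level 2).

Lemma cayley_sym : symmetric (cayley S).
Proof.
have [_ SV] := S_conn; move=> g h; rewrite /cayley.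
by apply/idP/idP => /SV; rewrite invMg invgK.
Qed.

Lemma adjmx_cayley : A = circ (fun g : gT => (g \in S)%:R).
Proof. by apply/matrixP => i j; rewrite !mxE. Qed.

(** Right translations preserve [h * g^-1], so they are graph automorphisms: their permutation
    matrices [T] commute with [A], hence with [U t]. *)
Lemma transition_cayley_translate (t : R) x w g :
  U t (enum_rank (x * g)%g) (enum_rank (w * g)%g) = U t (enum_rank x) (enum_rank w).
Proof.
pose T : 'M[K]_#|gT| := \matrix_(i, j) (enum_val j == enum_val i * g)%g%:R.
have TM (M : 'M[K]_#|gT|) i j : (T *m M) i j = M (enum_rank (enum_val i * g)%g) j.
  rewrite mxE (bigD1 (enum_rank (enum_val i * g)%g)) //= mxE enum_rankK eqxx mul1r.
  rewrite big1 ?addr0 // => k kE; rewrite mxE (_ : (_ == _) = false) ?mul0r //.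
  by apply: contraNF kE => /eqP <-; rewrite enum_valK.
have MT (M : 'M[K]_#|gT|) i j : (M *m T) i (enum_rank (enum_val j * g)%g) = M i j.
  rewrite mxE (bigD1 j) //= mxE enum_rankK eqxx mulr1.
  rewrite big1 ?addr0 // => k kE; rewrite mxE enum_rankK (inj_eq (mulIg g)).
  by rewrite (inj_eq enum_val_inj) eq_sym (negPf kE) mulr0.
have TA : T *m A = A *m T.
  apply/matrixP => i j.
  have -> : j = enum_rank (enum_val (enum_rank (enum_val j * g^-1)%g) * g)%g.
    by rewrite enum_rankK mulgKV enum_valK.
  by rewrite MT TM !mxE !enum_rankK /cayley invMg mulgA mulgK.
have /matrixP/(_ (enum_rank x) (enum_rank (w * g)%g)) :=
  transition_mx_comm cayley_sym t TA.
by rewrite TM enum_rankK -{2}(enum_rankK w) MT.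
Qed.

(* A unitary matrix with an entry of modulus 1 is monomial on that row, and right
   translations carry this to all rows: the transition matrix is a multiple of
   left translation by some z, which has order 2 since the matrix is symmetric. *)
Lemma pst_cayley : perfect_state_transfer R (cayley S) ->
  exists (tau : R) (z : gT) (lam : K), [/\ z != 1%g, (z * z)%g = 1%g, lam != 0,
    forall g, (z * g * z)%g \in S = (g \in S) &
    forall y : gT -> K, y^row *m U tau = lam *: (fun g => y (z * g)%g)^row].
Proof.
move=> [u [v [uv [tau Uvu]]]].
pose lam := U tau (enum_rank v) (enum_rank u).
have [z zE] : exists z, z = (u * v^-1)%g by exists (u * v^-1)%g.
have lam0 : lam != 0 by rewrite -normr_eq0 Uvu oner_eq0.
have Uv w : U tau (enum_rank v) (enum_rank w) = (w == u)%:R * lam.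
  have [->|wu] := eqVneq w u; first by rewrite mul1r.
  rewrite mul0r (unitarymx_norm1 (transition_mx_unitary cayley_sym tau) Uvu) //.
  by rewrite (inj_eq enum_rank_inj).
have UE x w : U tau (enum_rank x) (enum_rank w) = (w == z * x)%g%:R * lam.
  have := transition_cayley_translate tau v (w * (x^-1 * v))%g (v^-1 * x)%g.
  rewrite mulKVg -!mulgA mulKVg mulVg mulg1 Uv => ->; congr ((nat_of_bool _)%:R * _).
  by rewrite zE; apply/eqP/eqP => [<-|->]; rewrite !mulgA ?mulgK ?mulgKV ?mulgK ?mulgKV.
(* By symmetry the entry at [(u, v)] is the nonzero one at [(v, u)], which forces [v = z * u],
   whereas [u = z * v]. *)
have zz : (z * z = 1)%g.
  have := UE u v; rewrite -[U tau]tr_transition_mx ?mxE //; last exact: cayley_sym.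
  rewrite UE {1}zE mulgKV eqxx mul1r; case: eqP => [vE _|_ /eqP]; last first.
    by rewrite mul0r (negPf lam0).
  by apply: (mulIg u); rewrite -mulgA -vE zE mulgKV mul1g.
exists tau, z, lam; split=> //.
- by rewrite zE -eq_mulgV1.
(* In the entry [(1, w)] of [A *m U = U *m A] each side has only one possibly nonzero term:
   [k = z * w] on the left and [k = z] on the right. *)
- have zS w : ((z * w)%g \in S) = ((w * z)%g \in S).
    have /matrixP/(_ (enum_rank 1%g) (enum_rank w)) :=
      transition_mx_comm cayley_sym tau (erefl (A *m A)).
    rewrite !mxE (bigD1 (enum_rank (z * w)%g)) //= [X in _ + X]big1 => [|k kE]; last first.
      rewrite -(enum_valK k) UE (_ : (_ == _) = false) ?mul0r ?mulr0 //.
      by apply: contraNF kE => /eqP ->; rewrite mulgA zz mul1g enum_valK.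
    rewrite (bigD1 (enum_rank z)) //= [X in _ = _ + X]big1 => [|k kE]; last first.
      rewrite -(enum_valK k) UE mulg1 (_ : (_ == _) = false) ?mul0r //.
      by apply: contraNF kE => /eqP <-; rewrite enum_valK.
    rewrite !UE !mxE !enum_rankK !mulgA zz mulg1 mul1g !eqxx !mul1r !addr0 mulrC.
    move/(mulfI lam0)/eqP; rewrite /cayley invg1 mulg1 eqr_nat.
    have -> : (z^-1 = z)%g by apply: (mulIg z); rewrite mulVg zz.
    by move/eqP; case: (_ \in S); case: (_ \in S).
  by move=> g; rewrite -zS mulgA zz mul1g.
- move=> y; apply/rowP => j; rewrite !mxE (bigD1 (enum_rank (z * enum_val j)%g)) //=.
  have UE' i k : U tau i k = (enum_val k == z * enum_val i)%g%:R * lam.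
    by rewrite -UE !enum_valK.
  rewrite UE' mxE enum_rankK mulgA zz mul1g eqxx mul1r mulrC.
  rewrite big1 ?addr0 // => k kE; rewrite UE' (_ : (_ == _) = false) ?mul0r ?mulr0 //.
  by apply: contraNF kE => /eqP ->; rewrite mulgA zz mul1g enum_valK.
Qed.

End CayleyGraph.

(** * Subgroups of index two and lifting of eigenvectors *)

Section IndexTwo.
Variables (gT : finGroupType) (H : {group gT}).
Hypothesis iH : #|[set: gT] : H|%g = 2%N.

Lemma index2_mulr z g : z \notin H -> (g * z \in H)%g = (g \notin H).
Proof.
move=> zH; have [gH|gH] := boolP (g \in H); first by rewrite groupMl // (negPf zH).
have HC : (H :* z^-1 = ~: H)%g.
  apply/eqP; rewrite eqEcard; apply/andP; split.
    apply/fintype.subsetP => x; rewrite mem_rcoset invgK inE => xzH.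
    by apply: contra zH => xH; rewrite -(groupMl z xH).
  rewrite card_rcoset -(leq_add2l #|H|) cardsC -cardsT -(Lagrange (finset.subsetT H)) iH. by rewrite addnn muln2.
have : g \in (H :* z^-1)%g by rewrite HC inE gH.
by rewrite mem_rcoset invgK.
Qed.

Lemma index2_mull z g : z \notin H -> (z * g \in H)%g = (g \notin H).
Proof. by move=> zH; rewrite -groupV invMg index2_mulr groupV. Qed.

Lemma sum_subg (M : nmodType) (F : gT -> M) :
  \sum_(g in H) F g = \sum_(a : subg_of H) F (sgval a).
Proof.
rewrite (reindex (@sgval _ H)); first by apply: eq_bigl => a; exact: subgP.
by exists (subg H) => [a _|g gH]; [exact: sgvalK | exact: subgK].
Qed.

End IndexTwo.

Section Lift.
Variables (R : realType) (gT : finGroupType) (S : {set gT}) (H : {group gT}) (z : gT).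
Hypothesis iH : #|[set: gT] : H|%g = 2%N.
Hypothesis zH : z \notin H.
Hypothesis zz : (z * z = 1)%g.
Hypothesis zSz : forall g, (z * g * z)%g \in S = (g \in S).
Local Notation K := R[i].
Local Notation A := (adjmx R (cayley S)).

(* The element of the group algebra of H through which the sum of S acts on the
   eps-eigenspace of left translation by z, for eps = 1 or -1. *)
Definition fold_fun (eps : int) (a : subg_of H) : int :=
  (sgval a \in S)%:R + eps * (sgval a * z \in S)%g%:R.

(** The vector [x] on [H] is extended to the group by the rule [y (z * g) = eps * y g]. In the
    convolution with [S], a term [s = b * z] outside [H] contributes [eps] times the value at
    [b^-1 * a], which produces [fold_fun]. *)
Lemma fold_eigen_lift (eps : int) (x : 'rV[K]_#|subg_of H|) theta :
  eps * eps = 1 -> x != 0 ->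
  x *m circ (fun a => (fold_fun eps a)%:~R) = theta *: x ->
  exists y : gT -> K, [/\ \row_(j < #|gT|) y (enum_val j) != 0,
    (\row_(j < #|gT|) y (enum_val j)) *m A = theta *: \row_(j < #|gT|) y (enum_val j) &
    forall g, y (z * g)%g = eps%:~R * y g].
Proof.
move=> ee x0 xf; pose X a := x 0 (enum_rank a).
have xE : x = \row_j X (enum_val j) by apply/rowP => j; rewrite mxE /X enum_valK.
have eeK : eps%:~R * eps%:~R = 1 :> K by rewrite -intrM ee.
have Xf a : \sum_b X (b^-1 * a)%g * (fold_fun eps b)%:~R = theta * X a.
  move: xf; rewrite {1}xE mul_row_circ => /matrixP/(_ 0 (enum_rank a)).
  by rewrite !mxE enum_rankK.
pose y g := if g \in H then X (subg H g) else eps%:~R * X (subg H (z * g)%g).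
have yz g : y (z * g)%g = eps%:~R * y g.
  rewrite /y index2_mull // mulgA zz mul1g; case: (g \in H) => //=.
  by rewrite mulrA eeK mul1r.
have yH (b a : subg_of H) : y ((sgval b)^-1 * sgval a)%g = X (b^-1 * a)%g.
  by rewrite /y -[(_ * _)%g]/(sgval (b^-1 * a)%g) subgP sgvalK.
exists y; split=> //.
  apply: contraNneq x0 => y0; apply/eqP/rowP => j; rewrite xE !mxE.
  have /rowP/(_ (enum_rank (sgval (enum_val j)))) := y0.
  by rewrite !mxE enum_rankK /y subgP sgvalK.
have yA g : \sum_s y (s^-1 * g)%g * (s \in S)%:R = theta * y g; last first.
  rewrite adjmx_cayley mul_row_circ; apply/rowP => j; rewrite !mxE; exact: yA.
(* Conjugating the summation variable by [z], which preserves [S], shows that the convolution also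
   scales by [eps] under [z]; the eigenvalue equation then only has to be checked on [H]. *)
have yAz g' : \sum_s y (s^-1 * (z * g'))%g * (s \in S)%:R =
    eps%:~R * \sum_s y (s^-1 * g')%g * (s \in S)%:R.
  rewrite (reindex_inj (h := fun s => (z * s * z)%g)) => [|s t /mulIg/mulgI//].
  rewrite mulr_sumr; apply: eq_bigr => s _; rewrite zSz mulrA -yz; congr (y _ * _).
  have zV : (z^-1 = z)%g by apply: (mulIg z); rewrite mulVg zz.
  by rewrite !invMg zV -!mulgA (mulgA z z) zz mul1g.
wlog gH : g / g \in H.
  move=> yA; have [/yA//|gH] := boolP (g \in H).
  have := yAz (z * g)%g; rewrite mulgA zz mul1g => ->.
  by rewrite yA ?index2_mull // yz mulrCA !mulrA -(mulrA theta) eeK mulr1.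
have -> : g = sgval (subg H g) by rewrite subgK.
move: (subg H g) => a {g gH}.
transitivity (\sum_b X (b^-1 * a)%g * (fold_fun eps b)%:~R); last first.
  by rewrite Xf /y subgP sgvalK.
rewrite (bigID (mem H)) /=.
have -> : \sum_(s in H) y (s^-1 * sgval a)%g * (s \in S)%:R =
    \sum_b X (b^-1 * a)%g * (sgval b \in S)%:R.
  by rewrite sum_subg; apply: eq_bigr => b _; congr (_ * _); exact: yH.
have -> : \sum_(s | s \notin H) y (s^-1 * sgval a)%g * (s \in S)%:R =
    \sum_b X (b^-1 * a)%g * (eps%:~R * (sgval b * z \in S)%g%:R).
  rewrite (reindex_inj (mulIg z)) /=.
  rewrite (eq_bigl (mem H)) => [|s]; last by rewrite /= index2_mulr // negbK.
  rewrite sum_subg; apply: eq_bigr => b _.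
  have zV : (z^-1 = z)%g by apply: (mulIg z); rewrite mulVg zz.
  by rewrite invMg zV -mulgA yz yH mulrCA mulrA.
by rewrite -big_split; apply: eq_bigr => b _; rewrite /fold_fun rmorphD rmorphM /= mulrDr !rmorph_nat.
Qed.

End Lift.

(** Used with the list of all eigenvalues, this turns congruences for their phases into one for the
    trace. *)
Lemma sum_phase (R : realType) (tau c p : R) (r : seq R[i]) :
  (forall a, a \in r -> exists n : int, tau * complex.Re a - c = n%:~R * p) ->
  exists n : int, tau * complex.Re (\sum_(a <- r) a) - (size r)%:R * c = n%:~R * p.
Proof.
elim: r => [|a r IHr] ar.
  by exists 0; rewrite big_nil /= mulr0 !mul0r subr0.
have [|n nE] := IHr; first by move=> b br; apply: ar; rewrite inE br orbT.
have [k kE] := ar a (mem_head _ _); exists (k + n).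
rewrite big_cons intrD mulrDl -nE -kE /= -natr1.
by case: a {kE ar} => a1 a2; case: (\sum_(_ <- _) _) => b1 b2 /=; ring.
Qed.

Lemma Re_int (R : realType) (n : int) : complex.Re (n%:~R : R[i]) = n%:~R.
Proof. by rewrite -(rmorph_int (real_complex R)). Qed.

Lemma Re_mulrn (R : realType) (x : R[i]) n : complex.Re (x *+ n) = complex.Re x *+ n.
Proof. by elim: n => // n IHn; rewrite !mulrS -IHn; case: (x *+ n) => c d; case: x {IHn}. Qed.

(** The odd factor is invertible modulo 4, and a sum of two bits is at most 2. *)
Lemma dvd4_odd_mul (q : int) (b c : bool) :
  (4 %| (q * 2 + 1) * (b%:R + 1 * c%:R))%Z -> ~~ b && ~~ c.
Proof. by case: b; case: c => //=; lia. Qed.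

(** * The case of an abelian subgroup of odd order and index two *)

Section OddIndexTwo.
Variables (R : realType) (gT : finGroupType) (S : {set gT}) (H : {group gT}).
Hypothesis cH : abelian H.
Hypothesis iH : #|[set: gT] : H|%g = 2%N.
Hypothesis oH : odd #|H|.
Hypothesis S_conn : connection_set S.
Local Notation K := R[i].
Local Notation m := #|subg_of H|.

Lemma odd_subg : odd m.
Proof. by rewrite card_sub. Qed.

Lemma abelian_subg : abelian [set: subg_of H].
Proof.
apply/centsP => a _ b _; apply: val_inj.
exact: (centsP cH _ (subgP a) _ (subgP b)).
Qed.

Lemma involution_notin z : z != 1%g -> (z * z = 1)%g -> z \notin H.
Proof.
move=> z1 zz; apply/negP => zH; have := order_dvdG zH.
rewrite (nt_prime_order (p := 2)) // dvdn2 oH //.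
Qed.

(* On an eigenvector of the Cayley graph lifted from H, the transition matrix acts
   both by the phase expi (tau * theta) and as lam times left translation by z. *)
Lemma fold_phase tau z (lam : K) :
  z != 1%g -> (z * z = 1)%g -> (forall g, (z * g * z)%g \in S = (g \in S)) ->
  (forall y : gT -> K, (\row_(j < #|gT|) y (enum_val j)) *m transition_mx (cayley S) tau =
     lam *: \row_(j < #|gT|) y (z * enum_val j)%g) ->
  forall (eps : int) theta, eps * eps = 1 ->
  eigenvalue (circ (fun a : subg_of H => (fold_fun S z eps a)%:~R : K)) theta ->
  theta \is Num.real /\ expi (tau * complex.Re theta) = lam * eps%:~R.
Proof.
move=> z1 zz zSz zU eps theta ee /eigenvalueP[x xf x0].
have zH := involution_notin z1 zz.
have [y [y0 yA yz]] := fold_eigen_lift iH zH zz zSz ee x0 xf.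
split; first exact: (@eigenvalue_adjmx_real R _ _ (cayley_sym S_conn) _ _ y0 yA).
have := transition_mx_eigen (cayley_sym S_conn) tau yA; rewrite zU.
have /rV0Pn[j yj] := y0 => /rowP/(_ j); rewrite !mxE yz mulrA => /mulIf -> //.
by move: yj; rewrite mxE.
Qed.

Lemma pst_odd_index2_sub1 : perfect_state_transfer R (cayley S) ->
  exists z, forall s, s \in S -> s = z.
Proof.
move=> /(pst_cayley S_conn)[tau [z [lam [z1 zz lam0 zSz zU]]]].
have zH := involution_notin z1 zz.
have phase := fold_phase z1 zz zSz zU.
have [S1 _] := S_conn; have om := odd_subg; have m0 : (0 < m)%N by case: (m) om.
(* This is [|S|], because [H] and its coset by [z] partition the group. It is the eigenvalue of the
   all-ones vector, so its phase determines [lam]. *)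
pose k : int := \sum_(a : subg_of H) fold_fun S z 1 a.
have lamE : lam = expi (tau * k%:~R).
  have [|_] := phase 1 k%:~R (mulr1 1); last by rewrite Re_int mulr1.
  apply/eigenvalueP; exists (\row_(j < m) 1); last first.
    by apply/rV0Pn; exists (Ordinal m0); rewrite mxE oner_eq0.
  have := mul_row_circ (fun=> 1) (fun a : subg_of H => (fold_fun S z 1 a)%:~R : K).
  move=> ->; apply/rowP => j; rewrite !mxE mulr1 /k rmorph_sum.
  by under eq_bigr do rewrite mul1r.
have phase1 a : eigenvalue (circ (fun b : subg_of H => (fold_fun S z 1 b)%:~R : K)) a ->
    exists n : int, tau * complex.Re a - tau * k%:~R = n%:~R * (pi *+ 2).
  move=> /(phase 1 _ (mulr1 1))[_ aE]; apply: expi_eq1; apply: (mulIf lam0).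
  by rewrite {1}lamE -expiD subrK aE mulr1 mul1r.
have phaseN a : eigenvalue (circ (fun b : subg_of H => (fold_fun S z (-1) b)%:~R : K)) a ->
    exists n : int, tau * complex.Re a - (tau * k%:~R + pi) = n%:~R * (pi *+ 2).
  move=> /(phase (-1) _ (mulrNN 1 1))[_ aE]; apply: expi_eq1.
  apply: (mulIf (_ : - lam != 0)); first by rewrite oppr_eq0.
  rewrite mul1r -[- lam]mulrN1 -[in X in X = _]expi_pi {1}lamE -!expiD subrK aE.
  by rewrite intrN mulrN1.
(* Only the coefficient at [1] enters the trace. Since [1] is not in [S], that coefficient is [eps]
   times the indicator of [z] in [S]. *)
pose t : nat := z \in S.
have trace eps : complex.Re (\tr (circ (fun b : subg_of H => (fold_fun S z eps b)%:~R : K))) =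
    eps%:~R * t%:R * m%:R.
  rewrite mxtrace_circ Re_mulrn Re_int /fold_fun mul1g (negPf S1) add0r -/t.
  by rewrite -[LHS]mulr_natr intrM rmorph_nat.
have [r1 [sr1 /sum_phase[N1]]] := mxtrace_eigenvalues m0 phase1.
have [r2 [sr2 /sum_phase[N2]]] := mxtrace_eigenvalues m0 phaseN.
rewrite sr1 sr2 => N2E tr2 N1E tr1; rewrite -{}tr1 trace in N1E; rewrite -{}tr2 trace in N2E.
(* Subtracting the two trace congruences cancels [m * tau * k] and leaves
   [2 m t tau = pi (2 (N1 - N2) - m)]; the last factor is odd because [m] is. *)
have [q [w [w_odd oE]]] : (exists q w : int,
    w = q * 2 + 1 /\ 2 * m%:R * t%:R * tau = (pi : R) * w%:~R).
  exists (N1 - N2 - m./2%:Z - 1), ((N1 - N2) * 2 - m%:Z); split; first by lia.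
  rewrite intrB intrM intrB -pmulrn.
  transitivity (N1%:~R * (pi *+ 2) - N2%:~R * (pi *+ 2) - pi * m%:R : R); last by ring.
  by rewrite -N1E -N2E; ring.
have w0 : w != 0 by lia.
(* If [z] were not in [S], the left side of [oE] would vanish, but [pi * w] does not. *)
have t1 : t = 1%N.
  move: oE; rewrite /t; case: (z \in S) => //= /esym/eqP.
  by rewrite mulr0 mul0r mulf_eq0 intr_eq0 (negPf w0) orbF gt_eqF ?pi_gt0.
rewrite t1 mulr1 in oE.
pose g (a : subg_of H) : int := w * (fold_fun S z 1 a - k * (a == 1%g)%:R).
have g4 : forall a, (4 %| g a)%Z.
  apply: (@circ_dvd4 K _ g abelian_subg odd_subg) => al /eigenvalueP[x xg x0].
  have oK : w%:~R != 0 :> K by rewrite intr_eq0.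
  pose th := al / w%:~R + k%:~R.
  have alE : al = w%:~R * (th - k%:~R) by rewrite /th addrK mulrC divfK.
  have ev : eigenvalue (circ (fun b : subg_of H => (fold_fun S z 1 b)%:~R : K)) th.
    apply/eigenvalueP; exists x => //.
    have gE : circ (fun a => (g a)%:~R : K) =
        w%:~R *: (circ (fun b : subg_of H => (fold_fun S z 1 b)%:~R : K) - k%:~R%:M).
      apply/matrixP => i j; rewrite !mxE /g intrM intrB intrM -eq_mulgV1 (inj_eq enum_val_inj).
      by rewrite eq_sym; case: (i == j); rewrite ?(mulr1z, mulr0z, mulr1, mulr0, mulr1n, mulr0n).
    move: xg; rewrite gE -scalemxAr mulmxBr mul_mx_scalar alE -scalerA => /(scalerI oK).
    by rewrite scalerBl => /addIr.
  have [thR _] := phase 1 _ (mulr1 1) ev; have [n nE] := phase1 _ ev.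
  exists (m%:Z * n).
  (* After multiplication by [pi], replacing [pi * w] by [2 m tau] and [tau * (th - k)] by [2 pi n]
     gives [4 m n pi]. *)
  have : w%:~R * (complex.Re th - k%:~R) = (m%:Z * n * 4)%:~R :> R.
    have pi0 : (pi : R) != 0 by rewrite gt_eqF ?pi_gt0.
    apply: (mulfI pi0); rewrite mulrA -oE !intrM -pmulrn.
    transitivity (2 * m%:R * (tau * complex.Re th - tau * k%:~R)); first by ring.
    by rewrite nE; ring.
  move/(congr1 (real_complex R)); rewrite rmorphM rmorphB !rmorph_int /= RRe_real //.
  by rewrite -alE.
have g0 (a : subg_of H) : a != 1%g -> (sgval a \notin S) && (sgval a * z \notin S)%g.
  move=> a1; have := g4 a; rewrite /g (negPf a1) mulr0 subr0 /fold_fun w_odd.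
  exact: dvd4_odd_mul.
(* An element of [S] in [H] would have to be [1], which [S] excludes; one outside [H] is [b * z]
   with [b = s * z] in [H], and [b = 1] gives [s = z]. *)
exists z => s sS; have [sH|sH] := boolP (s \in H).
  have [/(congr1 (@sgval _ H))|/g0] := eqVneq (subg H s) 1%g; rewrite subgK //=.
    by move=> s1; move: sS; rewrite s1 (negPf S1).
  by rewrite sS.
have szH : (s * z \in H)%g by rewrite (index2_mulr iH).
have [/(congr1 (@sgval _ H))|/g0] := eqVneq (subg H (s * z)%g) 1%g; rewrite subgK //=.
  by move=> s1; apply: (mulIg z); rewrite zz.
by rewrite -mulgA zz mulg1 sS andbF.
Qed.

End OddIndexTwo.

(** An edge multiplies on the left by an element of [S], so no path starting at [1] leaves a
    subgroup containing [S]. *)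
Lemma connected_cayley_gen (gT : finGroupType) (S : {set gT}) (A : {group gT}) :
  S \subset A -> connected_graph (cayley S) -> forall g, g \in A.
Proof.
move=> /fintype.subsetP SA conn g.
have cl : fingraph.closed (cayley S) (mem A).
  by move=> x y /SA xy; rewrite /= -[y in RHS](mulgKV x) groupMl.
by rewrite -[g \in A](closed_connect cl (conn 1%g g)) /= group1.
Qed.

(** * The cocktail party graph: the complement of the matching of each [g] with [z * g] *)

Section CocktailParty.
Variables (R : realType) (gT : finGroupType) (z : gT).
Hypothesis z1 : z != 1%g.
Hypothesis zz : (z * z = 1)%g.
Hypothesis G4 : (4 %| #|gT|)%N.
Local Notation K := R[i].
Local Notation S := (~: [set 1%g; z]).

Let zV : (z^-1 = z)%g. Proof. by apply: (mulIg z); rewrite mulVg zz. Qed.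

Lemma cocktail_connection_set : connection_set S.
Proof.
split=> [|s]; first by rewrite !inE eqxx.
by rewrite !inE !negb_or -{2}zV (inj_eq invg_inj) invg_eq1.
Qed.

Lemma cocktail_connected : connected_graph (cayley S).
Proof.
have Sc x y : y != x -> y != (z * x)%g -> connect (cayley S) x y.
  move=> yx yzx; apply: connect1; rewrite /cayley !inE negb_or -eq_mulgV1 yx /=.
  by apply: contra yzx => /eqP <-; rewrite mulgKV.
move=> x y; have [->|yx] := eqVneq y x; first exact: connect0.
have [->|yzx] := eqVneq y (z * x)%g; last exact: Sc.
(* The vertices [x] and [z * x] are not adjacent; a third vertex, available as the order is at least
   4, is adjacent to both. *)
have [w wE] : exists w, w \notin [set x; (z * x)%g].
  have : (#|[set x; (z * x)%g]| < #|gT|)%N.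
    have g0 : (0 < #|gT|)%N by apply/card_gt0P; exists x.
    apply: leq_ltn_trans (_ : 2 < _)%N; last by have := dvdn_leq g0 G4; lia.
    by rewrite cards2; case: eqP.
  move=> lt; apply/existsP; apply: contraTT lt => /existsPn a; rewrite -leqNgt -cardsT.
  by apply: subset_leq_card; apply/fintype.subsetP => w _; have := a w; rewrite negbK.
move: wE; rewrite !inE negb_or => /andP[wx wzx].
apply: (connect_trans (Sc x w wx wzx)); apply: Sc; first by rewrite eq_sym.
by rewrite (inj_eq (mulgI z)) eq_sym.
Qed.

Lemma cocktail_pst : perfect_state_transfer R (cayley S).
Proof.
have S_conn := cocktail_connection_set.
exists 1%g, z; split; first by rewrite eq_sym.
exists (pi / 2).
pose n : K := #|gT|%:R.
pose A := adjmx R (cayley S).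
pose J : 'M[K]_#|gT| := const_mx 1.
pose L : 'M[K]_#|gT| := circ (fun x => (x == z)%:R).
have AE : A = J - 1%:M - L.
  apply/matrixP => i j; rewrite !mxE /cayley !inE negb_or -eq_mulgV1 (inj_eq enum_val_inj).
  rewrite [j == i]eq_sym; case: (eqVneq i j) => [->|ij].
    by rewrite mulgV eq_sym (negPf z1) /= subrr subr0.
  by case: eqP => _ /=; rewrite ?subr0 // subrr.
have LL : L *m L = 1%:M.
  rewrite mul_circ_delta zz; apply/matrixP => i j.
  by rewrite !mxE -eq_mulgV1 (inj_eq enum_val_inj) eq_sym.
have JL : J *m L = J.
  apply/matrixP => i j; rewrite !mxE.
  under eq_bigr do rewrite !mxE mul1r.
  rewrite (sum_enum_val (fun x => (enum_val j * x^-1 == z)%g%:R)) (bigD1 (z * enum_val j)%g) //=.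
  rewrite invMg zV mulKVg eqxx big1 ?addr0 // => x xE.
  case: eqP => // xz; case/eqP: xE.
  have -> : enum_val j = (z * x)%g by rewrite -xz mulgKV.
  by rewrite mulgA zz mul1g.
have LJ : L *m J = J.
  apply/matrixP => i j; rewrite !mxE.
  under eq_bigr do rewrite !mxE mulr1.
  rewrite (sum_enum_val (fun x => (x * (enum_val i)^-1 == z)%g%:R)) (bigD1 (z * enum_val i)%g) //=.
  rewrite mulgK eqxx big1 ?addr0 // => x xE.
  by case: eqP => // xz; case/eqP: xE; rewrite -xz mulgKV.
have JJ : J *m J = n *: J.
  apply/matrixP => i j; rewrite !mxE; under eq_bigr do rewrite !mxE mulr1.
  by rewrite sumr_const card_ord mulr1.
(* The two matrices are compared on eigenvectors. Multiplying the eigenvalue equation by [J] gives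
   [w *m J = 0] or [a = n - 2]; in the first case [L *m L = 1] forces [a = 0] or [a = -2]. *)
have U_eigen (w : 'rV[K]_#|gT|) a : w *m A = a *: w ->
    w *m transition_mx (cayley S) (pi / 2 : R) = - (w *m L).
  move=> wA; rewrite (transition_mx_eigen (cayley_sym S_conn) _ wA).
  have [->|w0] := eqVneq w 0; first by rewrite scaler0 mul0mx oppr0.
  have cancel (b c : K) : b *: w = c *: w -> b = c.
    move=> /eqP; rewrite -subr_eq0 -scalerBl scaler_eq0 (negPf w0) orbF subr_eq0.
    by move/eqP.
  have w1 : w *m J - w - w *m L = a *: w by rewrite -wA AE !mulmxBr mulmx1.
  have w2 : (n - 2 - a) *: (w *m J) = 0.
    have := congr1 (fun v => v *m J) w1; rewrite !mulmxBl -!mulmxA JJ LJ.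
    rewrite -scalemxAr -scalemxAl => /eqP; rewrite -subr_eq0 => /eqP <-.
    by rewrite !scalerBl (scalerDl _ 1 1) !scale1r opprD addrA.
  have [wJ|wJ] := eqVneq (w *m J) 0.
    have wL : w *m L = - (1 + a) *: w.
      by move: w1; rewrite wJ sub0r scaleNr scalerDl scale1r => <-; rewrite addrA subrr sub0r opprK.
    have : (1 + a) ^+ 2 = 1.
      apply: cancel; rewrite scale1r -[in RHS](mulmx1 w) -LL mulmxA wL -scalemxAl wL.
      by rewrite scalerA mulrNN expr2.
    move/eqP; rewrite sqrf_eq1 => /orP[] /eqP a1.
      have -> : a = 0 by apply: (addrI 1); rewrite a1 addr0.
      rewrite wL a1 mulr0 scaleNr opprK scale1r (_ : expi _ = 1) ?scale1r //.
      by have := expi_natpi R 0; rewrite mul0r expr0.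
    have -> : a = - 2 by apply: (addrI 1); rewrite a1; ring.
    rewrite wL a1 opprK scale1r (_ : expi _ = -1) ?scaleN1r //.
    apply/eqP; rewrite eq_complex /=.
    have -> : pi / 2 * - (1 + 1) = - pi :> R by field.
    by rewrite cosN sinN cospi sinpi oppr0 !eqxx.
  (* Here divisibility by 4 enters: [n - 2] is twice the odd number [2q + 1], so its phase at time
     [pi / 2] is [-1]. *)
  have [q nq] : exists q, #|gT| = (q.+1 * 4)%N.
    case/dvdnP: G4 => [[|q]] qE; last by exists q.
    have g0 : (0 < #|gT|)%N by apply/card_gt0P; exists z.
    by have := leq_trans g0 (eq_leq qE).
  have an : a = (q.*2.+1 * 2)%:R.
    move/eqP: w2; rewrite scaler_eq0 (negPf wJ) orbF subr_eq0 => /eqP <-.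
    apply: (addIr 2); rewrite subrK /n nq -natrD; congr _%:R; lia.
  have wL : w *m L = w.
    have a0 : a != 0 by rewrite an pnatr_eq0.
    have := congr1 (fun v => v *m L) w1; rewrite !mulmxBl -!mulmxA LL JL mulmx1 -scalemxAl.
    by rewrite addrAC w1 => /(scalerI a0).
  rewrite wL (_ : expi _ = -1) ?scaleN1r //.
  have -> : pi / 2 * complex.Re a = (q.*2.+1)%:R * pi :> R.
    by rewrite an Re_mulrn /= natrM; field.
  by rewrite expi_natpi exprS -muln2 exprM sqrr_sign mulr1.
have UL : transition_mx (cayley S) (pi / 2 : R) = - L.
  have uP := spectral_unit A.
  (* The rows of the invertible spectral matrix are eigenvectors, so agreement on eigenvectors gives
     equality. *)
  apply: (can_inj (mulKmx uP)); apply/row_matrixP => i.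
  rewrite !row_mul mulmxN; apply: (U_eigen _ (spectral_diag A 0 i)).
  rewrite -row_mul [X in _ *m X](@adjmx_spectral R _ _ (cayley_sym S_conn)) !mulmxA mulmxV // mul1mx.
  by rewrite row_mul row_diag_mx -scalemxAl -rowE.
by rewrite UL !mxE normrN !enum_rankK mul1g zV eqxx normr1.
Qed.

End CocktailParty.

Theorem theorem5p6 (R : realType) (gT : finGroupType)
    (nonabG : ~~ abelian [set: gT])
    (index2 : exists H : {group gT}, abelian H /\ #|[set: gT] : H|%g = 2%N) :
  (exists S : {set gT},
     [/\ connection_set S, connected_graph (cayley S)
       & perfect_state_transfer R (cayley S)])
  <-> (4 %| #|[set: gT]|)%N.
Proof.
split=> [[S [S_conn conn pst]]|].
  have [H [cH iH]] := index2.
  have -> : #|[set: gT]| = (#|H| * 2)%N by rewrite -(Lagrange (finset.subsetT H)) iH.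
  rewrite (@dvdn_pmul2r 2 2) // dvdn2; apply/negP => oH.
  have [z Sz] := pst_odd_index2_sub1 cH iH oH S_conn pst.
  (* With [S] inside [[set z]], connectedness would make the whole group the cyclic group generated
     by [z]. *)
  case/negP: nonabG; apply: abelianS (cycle_abelian z).
  apply/fintype.subsetP => g _; apply: (connected_cayley_gen _ conn).
  by apply/fintype.subsetP => s /Sz ->; exact: cycle_id.
rewrite cardsT => G4.
have [|z _ z2] := Cauchy (p := 2) (G := [set: gT]) (isT : prime 2).
  by rewrite cardsT; apply: dvdn_trans G4.
have z1 : z != 1%g by rewrite -order_gt1 z2.
have zz : (z * z = 1)%g by rewrite -(expg_order z) z2.
exists (~: [set 1%g; z]); split.
- exact: cocktail_connection_set.
- exact: cocktail_connected.
- exact: cocktail_pst.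
Qed.
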